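(* Let $(K,v)$ be a nontrivially valued field of characteristic $p>0$. If $K$ admits only finitely many distinct Artin-Schreier extensions, then $(K,v)$ is a semitame field.
   Context: Valuations are Krull valuations of arbitrary rank, written additively; $vK$ is the value group and $Kv$ the residue field of $(K,v)$. An Artin-Schreier extension of a field $K$ of characteristic $p>0$ is a Galois extension of degree $p$; equivalently, a nontrivial extension generated by a root of a polynomial $X^p-X-b$ with $b\in K$. A valued field $(K,v)$ is called semitame if either $\mathrm{char}\,Kv=0$, or $\mathrm{char}\,Kv=p>0$ and the following two axioms hold: (DRst) the value group $vK$ is $p$-divisible; (DRvr) the homomorphism $\mathcal{O}_{K^c}/p\mathcal{O}_{K^c}\to \mathcal{O}_{K^c}/p\mathcal{O}_{K^c}$, $x\mapsto x^p$, is surjective, where $\mathcal{O}_{K^c}$ denotes the valuation ring of the completion $K^c$ of $(K,v)$. *)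

(* Defs.v *)
From HB Require Import structures.
From mathcomp Require Import all_boot all_order all_algebra all_field.
From mathcomp Require Import orderedzmod ring_quotient.
From mathcomp Require Import boolp classical_sets functions.

Set Implicit Arguments.
Unset Strict Implicit.
Unset Printing Implicit Defensive.

Import Order.TTheory GRing.Theory Num.Theory.
Local Open Scope ring_scope.
Local Open Scope quotient_scope.

Record orderedZmodType := OrderedZmodType {
  oz_zmod : zmodType;
  oz_le : rel oz_zmod;
  oz_le_anti : antisymmetric oz_le;
  oz_le_trans : transitive oz_le;
  oz_le_total : total oz_le;
  oz_leD : forall z x y, oz_le x y -> oz_le (z + x) (z + y)
}.

(* The carrier is a definition of its own so that it can bear the order
   structure of MathComp beside the group structure; a packed structure joining
   the two cannot be declared after that of [realDomainType]. *)
Definition oz_sort (G : orderedZmodType) : Type := oz_zmod G.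
Coercion oz_sort : orderedZmodType >-> Sortclass.

Section OrderedZmoduleInstances.
Variable G : orderedZmodType.

HB.instance Definition _ := GRing.Zmodule.on (oz_sort G).

Let le : rel (oz_sort G) := @oz_le G.

Lemma oz_le_refl : reflexive le.
Proof. by move=> x; have := @oz_le_total G x x; rewrite orbb. Qed.

HB.instance Definition _ := Order.Le_isPOrder.Build ring_display (oz_sort G)
  oz_le_refl (@oz_le_anti G) (@oz_le_trans G).
HB.instance Definition _ :=
  Order.POrder_isTotal.Build ring_display (oz_sort G) (@oz_le_total G).

Lemma ozD2l (z x y : G) : x <= y -> z + x <= z + y.
Proof. exact: oz_leD. Qed.

End OrderedZmoduleInstances.

Section OrderedZmoduleTheory.
Variable G : orderedZmodType.
Implicit Types x y z t : G.

Lemma oz_leD2l z x y : (z + x <= z + y) = (x <= y).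
Proof.
apply/idP/idP; last exact: ozD2l.
by move=> /(ozD2l (- z)); rewrite !addKr.
Qed.

Lemma oz_leD2r z x y : (x + z <= y + z) = (x <= y).
Proof. by rewrite ![_ + z]addrC oz_leD2l. Qed.

Lemma oz_ltD2l z x y : (z + x < z + y) = (x < y).
Proof. by rewrite !ltNge oz_leD2l. Qed.

Lemma oz_ltD2r z x y : (x + z < y + z) = (x < y).
Proof. by rewrite !ltNge oz_leD2r. Qed.

Lemma oz_leDD x y z t : x <= y -> z <= t -> x + z <= y + t.
Proof. by move=> xy zt; rewrite (le_trans (ozD2l x zt))// oz_leD2r. Qed.

Lemma oz_lt_leD x y z t : x < y -> z <= t -> x + z < y + t.
Proof. by move=> xy zt; rewrite (le_lt_trans (ozD2l x zt))// oz_ltD2r. Qed.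

Lemma oz_le_ltD x y z t : x <= y -> z < t -> x + z < y + t.
Proof. by move=> xy zt; rewrite addrC [y + t]addrC oz_lt_leD. Qed.

Lemma oz_double0 x : x + x = 0 -> x = 0.
Proof.
move=> xx; have [x0|x0|//] := ltgtP x 0.
- by have := oz_lt_leD x0 (ltW x0); rewrite xx addr0 ltxx.
- by have := oz_lt_leD x0 (ltW x0); rewrite xx addr0 ltxx.
Qed.

End OrderedZmoduleTheory.

(* A valuation is a map on the nonzero elements of [K]: the value at [0], which
   is conventionally infinite, is left unspecified here and never used.
   Surjectivity says that [G] is the value group [vK]. *)
Record valuation (K : fieldType) (G : orderedZmodType) := Valuation {
  val_fun :> K -> G;
  valM : forall x y, x != 0 -> y != 0 -> val_fun (x * y) = val_fun x + val_fun y;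
  valD : forall x y, x != 0 -> y != 0 -> x + y != 0 ->
    Order.min (val_fun x) (val_fun y) <= val_fun (x + y);
  val_surj : forall g, exists2 x, x != 0 & val_fun x = g
}.

Definition nontrivial_valuation (K : fieldType) (G : orderedZmodType)
    (v : valuation K G) : Prop :=
  exists2 x : K, x != 0 & v x != 0.

(* [g <= v x] and [g < v x], under the convention that [v 0] is infinite *)
Definition vle (K : fieldType) (G : orderedZmodType) (v : valuation K G)
    (g : G) (x : K) : bool :=
  (x == 0) || (g <= v x).

Definition vlt (K : fieldType) (G : orderedZmodType) (v : valuation K G)
    (g : G) (x : K) : bool :=
  (x == 0) || (g < v x).

Section ValuationTheory.
Variables (K : fieldType) (G : orderedZmodType) (v : valuation K G).
Implicit Types (x y e : K) (g h : G).

Lemma val1 : v 1 = 0.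
Proof.
have := valM v (oner_neq0 K) (oner_neq0 K).
by rewrite mulr1 => /(congr1 (+%R^~ (- v 1))); rewrite addrK subrr.
Qed.

Lemma valN1 : v (- 1) = 0.
Proof.
have N1 : - 1 != 0 :> K by rewrite oppr_eq0 oner_neq0.
by apply: oz_double0; rewrite -valM// mulrNN mulr1 val1.
Qed.

Lemma valN x : v (- x) = v x.
Proof.
have [->|x0] := eqVneq x 0; first by rewrite oppr0.
by rewrite -mulN1r valM ?oppr_eq0 ?oner_neq0// valN1 add0r.
Qed.

Lemma valV x : x != 0 -> v x^-1 = - v x.
Proof.
move=> x0; apply/eqP; rewrite -addr_eq0; apply/eqP.
by rewrite -valM ?invr_eq0// mulVf// val1.
Qed.

Lemma vle0 g : vle v g 0. Proof. by rewrite /vle eqxx. Qed.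
Lemma vlt0 g : vlt v g 0. Proof. by rewrite /vlt eqxx. Qed.

Lemma vltW g x : vlt v g x -> vle v g x.
Proof. by case/orP => [/eqP->|/ltW gx]; rewrite ?vle0// /vle gx orbT. Qed.

Lemma vle_trans g h x : g <= h -> vle v h x -> vle v g x.
Proof.
by move=> gh /orP[/eqP->|/(le_trans gh) hx]; rewrite ?vle0// /vle hx orbT.
Qed.

Lemma vlt_trans g h x : g <= h -> vlt v h x -> vlt v g x.
Proof.
by move=> gh /orP[/eqP->|/(le_lt_trans gh) hx]; rewrite ?vlt0// /vlt hx orbT.
Qed.

Lemma vleD g x y : vle v g x -> vle v g y -> vle v g (x + y).
Proof.
rewrite /vle; have [->|x0] := eqVneq x 0; first by rewrite add0r.
have [->|y0] := eqVneq y 0; first by rewrite addr0 (negPf x0).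
move=> /= gx gy; have [//|xy0] := eqVneq (x + y) 0.
by rewrite (le_trans _ (valD v x0 y0 xy0))// le_min gx.
Qed.

Lemma vltD g x y : vlt v g x -> vlt v g y -> vlt v g (x + y).
Proof.
rewrite /vlt; have [->|x0] := eqVneq x 0; first by rewrite add0r.
have [->|y0] := eqVneq y 0; first by rewrite addr0 (negPf x0).
move=> /= gx gy; have [//|xy0] := eqVneq (x + y) 0.
by rewrite (lt_le_trans _ (valD v x0 y0 xy0))// lt_min gx.
Qed.

Lemma vleN g x : vle v g (- x) = vle v g x.
Proof. by rewrite /vle oppr_eq0 valN. Qed.

Lemma vltN g x : vlt v g (- x) = vlt v g x.
Proof. by rewrite /vlt oppr_eq0 valN. Qed.

Lemma vltB g x y : vlt v g x -> vlt v g y -> vlt v g (x - y).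
Proof. by move=> gx gy; rewrite vltD ?vltN. Qed.

Lemma vltBC g x y : vlt v g (x - y) = vlt v g (y - x).
Proof. by rewrite -vltN opprB. Qed.

Lemma vleM g h x y : vle v g x -> vle v h y -> vle v (g + h) (x * y).
Proof.
rewrite /vle mulf_eq0; case: eqVneq => //= x0; case: eqVneq => //= y0.
by move=> gx hy; rewrite valM// oz_leDD.
Qed.

Lemma vltM g h x y : vle v g x -> vlt v h y -> vlt v (g + h) (x * y).
Proof.
rewrite /vle /vlt mulf_eq0; case: eqVneq => //= x0; case: eqVneq => //= y0.
by move=> gx hy; rewrite valM// oz_le_ltD.
Qed.

Lemma vle_val x : vle v (v x) x. Proof. by rewrite /vle lexx orbT. Qed.

Lemma val_close x e : x != 0 -> vlt v (v x) e -> x + e != 0 /\ v (x + e) = v x.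
Proof.
move=> x0 /orP[/eqP->|xe]; first by rewrite addr0.
have [->|e0] := eqVneq e 0; first by rewrite addr0.
have xe0 : x + e != 0.
  by apply: contraTneq xe => /eqP; rewrite addr_eq0 => /eqP ->; rewrite valN ltxx.
split=> //; apply/eqP; rewrite eq_le; apply/andP; split; last first.
  by rewrite (le_trans _ (valD v x0 e0 xe0))// le_min lexx ltW.
have eN0 : - e != 0 by rewrite oppr_eq0.
have := valD v xe0 eN0; rewrite addrK valN => /(_ x0).
by rewrite ge_min => /orP[//|]; rewrite leNgt xe.
Qed.

End ValuationTheory.

Section ValuationRing.
Variables (K : fieldType) (G : orderedZmodType) (v : valuation K G).

Definition vring_pred : {pred K} := vle v 0.

Lemma vring_subring_closed : subring_closed vring_pred.
Proof.
split=> [|x y|x y]; rewrite /in_mem /=.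
- by rewrite /vring_pred /vle val1 lexx orbT.
- by move=> Ox Oy; apply: vleD => //; rewrite vleN.
- by move=> Ox Oy; have := vleM Ox Oy; rewrite addr0.
Qed.

HB.instance Definition _ :=
  GRing.isSubringClosed.Build K vring_pred vring_subring_closed.

Record vring := VRing { vring_val : K; vring_valP : vring_val \in vring_pred }.

HB.instance Definition _ := [isSub for vring_val].
HB.instance Definition _ := [Choice of vring by <:].
HB.instance Definition _ := [SubChoice_isSubComNzRing of vring by <:].

Definition vmax_pred : {pred vring} := fun x => vlt v 0 (vring_val x).

Lemma vmax_idealr_closed : idealr_closed vmax_pred.
Proof.
split=> [||a x y]; rewrite /in_mem /= /vmax_pred /=.
- exact: vlt0.
- by rewrite /vlt val1 ltxx orbF oner_neq0.
- move=> mx my; apply: vltD => //.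
  by have := vltM (vring_valP a) mx; rewrite addr0.
Qed.

HB.instance Definition _ := isIdealr.Build vring vmax_pred vmax_idealr_closed.

Definition residue_field := {ideal_quot vmax_pred}.

HB.instance Definition _ := GRing.ComNzRing.on residue_field.

Definition residue : vring -> residue_field := \pi_residue_field.

Lemma vring_inv_subproof (a : vring) :
  ~~ vmax_pred a -> (vring_val a)^-1 \in vring_pred.
Proof.
rewrite /in_mem /= /vmax_pred /vlt negb_or -leNgt => /andP[a0 va].
rewrite /vring_pred /vle valV//.
by rewrite -(oz_leD2r (v (vring_val a))) add0r addNr va orbT.
Qed.

Definition residue_inv (x : residue_field) : residue_field :=
  if x == 0 then 0 else residue (insubd (0 : vring) (vring_val (repr x))^-1).

Lemma residue_mulVf x : x != 0 -> residue_inv x * x = 1.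
Proof.
move=> x0; rewrite /residue_inv (negPf x0).
have mx : ~~ vmax_pred (repr x).
  apply: contra x0 => mx; rewrite -[x]reprK.
  by rewrite piE /Quotient.equiv subr0.
rewrite -{2}[x]reprK; set a := repr x in mx *.
rewrite /residue; transitivity (\pi_residue_field (1 : vring)); last by rewrite !piE.
rewrite [LHS](_ : _ = \pi_residue_field (insubd (0 : vring) (vring_val a)^-1 * a)).
  congr (\pi _); apply: val_inj => /=.
  rewrite insubdK ?vring_inv_subproof// mulVf//.
  by apply: contra mx => /eqP a0; rewrite /vmax_pred a0 vlt0.
by rewrite !piE.
Qed.

Lemma residue_inv0 : residue_inv 0 = 0.
Proof. by rewrite /residue_inv eqxx. Qed.

HB.instance Definition _ :=
  GRing.ComNzRing_isField.Build residue_field residue_mulVf residue_inv0.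

End ValuationRing.

Definition eventually (G : orderedZmodType) (P : G -> Prop) : Prop :=
  exists d0 : G, forall d : G, d0 <= d -> P d.

Section Eventually.
Variable G : orderedZmodType.
Implicit Types P Q : G -> Prop.

Lemma ev_and P Q :
  eventually P -> eventually Q -> eventually (fun d => P d /\ Q d).
Proof.
move=> [d0 Pd] [d1 Qd]; exists (Order.max d0 d1) => d.
by rewrite ge_max => /andP[/Pd ? /Qd].
Qed.

Lemma ev_imp P Q : (forall d, P d -> Q d) -> eventually P -> eventually Q.
Proof. by move=> PQ [d0 Pd]; exists d0 => d /Pd/PQ. Qed.

Lemma ev_ex P : eventually P -> exists d, P d.
Proof. by move=> [d0 Pd]; exists d0; apply: Pd. Qed.

End Eventually.

(* Cauchy nets and null nets for the topology of [v]. Since the balls around [0]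
   are indexed by [vK], nets indexed by [vK] itself suffice. *)
Definition cauchy_net (K : fieldType) (G : orderedZmodType) (v : valuation K G)
    (a : G -> K) : Prop :=
  forall g : G, exists d0 : G, forall d e : G,
    d0 <= d -> d0 <= e -> vlt v g (a d - a e).

Definition null_net (K : fieldType) (G : orderedZmodType) (v : valuation K G)
    (a : G -> K) : Prop :=
  forall g : G, eventually (fun d => vlt v g (a d)).

Definition net_cvg (K : fieldType) (G : orderedZmodType) (v : valuation K G)
    (a : G -> K) (x : K) : Prop :=
  null_net v (fun d => a d - x).

Section CauchyNets.
Variables (K : fieldType) (G : orderedZmodType) (v : valuation K G).
Implicit Types (a b : G -> K) (g : G).

Lemma cauchy_bounded a :
  cauchy_net v a -> exists g, eventually (fun d => vle v g (a d)).
Proof.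
move=> /(_ 0)[d0 ca]; exists (Order.min 0 (v (a d0))), d0 => d dd.
rewrite -[a d](subrK (a d0)); apply: vleD.
  by apply: vle_trans (vltW (ca _ _ dd (lexx _))); rewrite ge_min lexx.
by apply: vle_trans (vle_val v _); rewrite ge_min lexx orbT.
Qed.

Lemma cauchy_cst (x : K) : cauchy_net v (fun=> x).
Proof. by move=> g; exists 0 => d e _ _; rewrite subrr vlt0. Qed.

Lemma cauchyB a b :
  cauchy_net v a -> cauchy_net v b -> cauchy_net v (fun d => a d - b d).
Proof.
move=> ca cb g; have [[d0 da] [d1 db]] := (ca g, cb g).
exists (Order.max d0 d1) => d e; rewrite !ge_max => /andP[? ?] /andP[? ?].
rewrite (_ : _ - _ = (a d - a e) - (b d - b e)); last by rewrite !opprD addrACA.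
by apply: vltB; [apply: da|apply: db].
Qed.

Lemma cauchyM a b :
  cauchy_net v a -> cauchy_net v b -> cauchy_net v (fun d => a d * b d).
Proof.
move=> ca cb g.
have [ga [d0 ba]] := cauchy_bounded ca; have [gb [d1 bb]] := cauchy_bounded cb.
have [[d2 da] [d3 db]] := (ca (g - gb), cb (g - ga)).
exists (Order.max (Order.max d0 d1) (Order.max d2 d3)) => d e.
rewrite !ge_max => /andP[/andP[? ?] /andP[? ?]] /andP[/andP[? ?] /andP[? ?]].
rewrite (_ : _ - _ = a d * (b d - b e) + b e * (a d - a e)).
  apply: vltD.
    by rewrite -(subrKC ga g) vltM ?ba ?db.
  by rewrite -(subrKC gb g) vltM ?bb ?da.
by rewrite !mulrBr [b e * a d]mulrC [b e * a e]mulrC addrA subrK.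
Qed.

Lemma cauchy_val a : cauchy_net v a -> ~ null_net v a ->
  exists g, eventually (fun d => a d != 0 /\ v (a d) = g).
Proof.
move=> ca /existsNP[g na]; have [d0 da] := ca g.
have [d1 [dd nd]] : exists d1, d0 <= d1 /\ ~ vlt v g (a d1).
  apply: contrapT => N; apply: na; exists d0 => d dd.
  by apply: contrapT => nd; apply: N; exists d.
move/negP: nd; rewrite /vlt negb_or -leNgt => /andP[a0 ag].
exists (v (a d1)), d0 => d d0d; rewrite -[a d](subrK (a d1)) addrC.
by apply: val_close => //; apply: vlt_trans (da _ _ d0d dd).
Qed.

Lemma null_cauchy a : null_net v a -> cauchy_net v a.
Proof.
by move=> na g; have [d0 nd] := na g; exists d0 => d e ? ?; rewrite vltB ?nd.
Qed.

Lemma null0 : null_net v (fun=> 0).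
Proof. by move=> g; exists 0 => d _; rewrite vlt0. Qed.

Lemma null1 : ~ null_net v (fun=> 1).
Proof.
by move=> /(_ 0)/ev_ex[_]; rewrite /vlt val1 ltxx orbF oner_eq0.
Qed.

Lemma nullD a b :
  null_net v a -> null_net v b -> null_net v (fun d => a d + b d).
Proof.
by move=> na nb g; apply: ev_imp (ev_and (na g) (nb g)) => d [? ?]; apply: vltD.
Qed.

Lemma nullM a b :
  cauchy_net v a -> null_net v b -> null_net v (fun d => a d * b d).
Proof.
move=> /cauchy_bounded[ga ba] nb g.
apply: ev_imp (ev_and ba (nb (g - ga))) => d [? ?].
by rewrite -(subrKC ga g) vltM.
Qed.

Lemma cauchyV a : cauchy_net v a -> ~ null_net v a ->
  cauchy_net v (fun d => (a d)^-1).
Proof.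
move=> ca na g; have [h [d0 ah]] := cauchy_val ca na.
have [d1 da] := ca (g + (h + h)).
exists (Order.max d0 d1) => d e; rewrite !ge_max => /andP[/ah[ad0 adh] ?].
move=> /andP[/ah[ae0 aeh] ?].
rewrite (_ : _ - _ = ((a d)^-1 * (a e)^-1) * (a e - a d)).
  rewrite (_ : g = (- h - h) + (g + (h + h))).
    by rewrite vltM ?da// vleM// /vle valV ?adh ?aeh ?lexx ?orbT.
  by rewrite -opprD addrC addrK.
by rewrite mulrBr mulfVK// [_^-1 * _]mulrC mulfVK.
Qed.

End CauchyNets.

Section Completion.
Variables (K : fieldType) (G : orderedZmodType) (v : valuation K G).

Definition cauchy_pred : {pred G -> K} := fun a => `[< cauchy_net v a >].

Lemma cauchy_subring_closed : subring_closed cauchy_pred.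
Proof.
split=> [|a b /asboolP ca /asboolP cb|a b /asboolP ca /asboolP cb]; apply/asboolP.
- exact: cauchy_cst.
- exact: cauchyB.
- exact: cauchyM.
Qed.

HB.instance Definition _ :=
  GRing.isSubringClosed.Build (G -> K) cauchy_pred cauchy_subring_closed.

Record cauchy := Cauchy { net : G -> K; net_in : net \in cauchy_pred }.

HB.instance Definition _ := [isSub for net].
HB.instance Definition _ := [Choice of cauchy by <:].
HB.instance Definition _ := GRing.SubChoice_isSubComPzRing.Build
  (G -> K) cauchy_pred cauchy cauchy_subring_closed.

Lemma netP (a : cauchy) : cauchy_net v (net a).
Proof. exact/asboolP/net_in. Qed.

Lemma cauchy_oner_neq0 : (1 : cauchy) != 0.
Proof.
apply/eqP => /(congr1 net)/(congr1 (fun a => a 0))/eqP.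
by rewrite oner_eq0.
Qed.

HB.instance Definition _ := GRing.PzSemiRing_isNonZero.Build cauchy cauchy_oner_neq0.

Definition null_pred : {pred cauchy} := fun a => `[< null_net v (net a) >].

Lemma null_idealr_closed : idealr_closed null_pred.
Proof.
split=> [||a x y /asboolP nx /asboolP ny].
- exact/asboolP/null0.
- by apply/asboolP/null1.
- by apply/asboolP; apply: nullD => //; apply: nullM nx; apply: netP.
Qed.

HB.instance Definition _ := isIdealr.Build cauchy null_pred null_idealr_closed.

(* the ring of Cauchy nets modulo the ideal of null nets *)
Definition completion := {ideal_quot null_pred}.

HB.instance Definition _ := GRing.ComNzRing.on completion.

Definition cpi : cauchy -> completion := \pi_completion.

Lemma cpiB : {morph cpi : a b / a - b}.
Proof. by move=> a b; rewrite /cpi !piE. Qed.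
Lemma cpiD : {morph cpi : a b / a + b}.
Proof. by move=> a b; rewrite /cpi !piE. Qed.
Lemma cpiM : {morph cpi : a b / a * b}.
Proof. by move=> a b; rewrite /cpi !piE. Qed.
Lemma cpi1 : cpi 1 = 1.
Proof. by rewrite /cpi !piE. Qed.
Lemma cpi_repr (x : completion) : cpi (repr x) = x.
Proof. exact: reprK. Qed.

Lemma cpi_eq0 a : reflect (null_net v (net a)) (cpi a == 0).
Proof. by rewrite /cpi piE /Quotient.equiv subr0; apply: asboolP. Qed.

Lemma cpi_eq a b : cpi a = cpi b <-> null_net v (fun d => net a d - net b d).
Proof.
split=> [ab|nab]; last by apply/eqP; rewrite -subr_eq0 -cpiB; apply/cpi_eq0.
by apply: (elimT (cpi_eq0 (a - b))); rewrite cpiB ab subrr.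
Qed.

Definition mkcauchy (a : G -> K) (ca : cauchy_net v a) : cauchy :=
  Cauchy (asboolT ca).

Definition completion_inv (x : completion) : completion :=
  match pselect (x = 0) with
  | left _ => 0
  | right x0 => cpi (insubd (0 : cauchy) (fun d => (net (repr x) d)^-1))
  end.

Lemma repr_not_null (x : completion) : x != 0 -> ~ null_net v (net (repr x)).
Proof. by move=> x0 /cpi_eq0; rewrite cpi_repr (negPf x0). Qed.

Lemma completion_mulVf x : x != 0 -> completion_inv x * x = 1.
Proof.
move=> x0; rewrite /completion_inv; case: pselect => [/eqP|_].
  by rewrite (negPf x0).
have nx := repr_not_null x0; rewrite -{2}[x]cpi_repr -cpiM -cpi1.
apply/cpi_eq => g; rewrite /= insubdK; last exact/asboolP/cauchyV/nx/netP.
have [h [d0 xh]] := cauchy_val (@netP (repr x)) nx.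
by exists d0 => d /xh[xd _]; rewrite /= [X in vlt _ _ (X - _)]mulVf// subrr vlt0.
Qed.

Lemma completion_inv0 : completion_inv 0 = 0.
Proof. by rewrite /completion_inv; case: pselect. Qed.

HB.instance Definition _ :=
  GRing.ComNzRing_isField.Build completion completion_mulVf completion_inv0.

(* the value of a nonzero class is the eventual value of any of its nets *)
Definition completion_val_fun (x : completion) : G :=
  xget 0 [set g | eventually (fun d => net (repr x) d != 0 /\ v (net (repr x) d) = g)].

Lemma completion_valE (a : cauchy) (g : G) :
  eventually (fun d => net a d != 0 /\ v (net a d) = g) ->
  cpi a != 0 /\ completion_val_fun (cpi a) = g.
Proof.
move=> ag; have a0 : cpi a != 0.
  apply/cpi_eq0 => /(_ g)/ev_and/(_ ag)/ev_ex[d [nd [d0 dg]]].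
  by move: nd; rewrite /vlt (negPf d0) dg ltxx.
split=> //; rewrite /completion_val_fun.
have /cpi_eq/(_ g) rg : cpi (repr (cpi a)) = cpi a by rewrite cpi_repr.
have {}rg : eventually (fun d =>
    net (repr (cpi a)) d != 0 /\ v (net (repr (cpi a)) d) = g).
  apply: ev_imp (ev_and rg ag) => d [nd [d0 dg]].
  by rewrite -[net (repr _) d](subrK (net a d)) addrC -dg; apply: val_close;
    rewrite ?dg.
case: xgetP => [h _ /= hg|/(_ g)//].
by have [d [[_ <-] [_ <-]]] := ev_ex (ev_and hg rg).
Qed.

Lemma completion_valP (x : completion) : x != 0 ->
  eventually (fun d => net (repr x) d != 0 /\
                       v (net (repr x) d) = completion_val_fun x).
Proof.
move=> x0; have [g xg] := cauchy_val (@netP (repr x)) (repr_not_null x0).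
by have [_] := completion_valE xg; rewrite cpi_repr => ->.
Qed.

Lemma completion_valM x y : x != 0 -> y != 0 ->
  completion_val_fun (x * y) = completion_val_fun x + completion_val_fun y.
Proof.
move=> /completion_valP vx /completion_valP vy.
rewrite -{1}[x]cpi_repr -{1}[y]cpi_repr -cpiM; apply: (completion_valE _).2.
apply: ev_imp (ev_and vx vy) => d [[x0 <-] [y0 <-]] /=.
by rewrite mulf_neq0// [v (_ * _)]valM.
Qed.

Lemma completion_valD x y : x != 0 -> y != 0 -> x + y != 0 ->
  Order.min (completion_val_fun x) (completion_val_fun y) <=
    completion_val_fun (x + y).
Proof.
move=> /completion_valP vx /completion_valP vy xy0.
have [h xyh] : exists h, eventually (fun d => net (repr x + repr y) d != 0 /\
    v (net (repr x + repr y) d) = h).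
  by apply: cauchy_val (@netP _) _ => /cpi_eq0; rewrite cpiD !cpi_repr (negPf xy0).
have [_] := completion_valE xyh; rewrite cpiD !cpi_repr => ->.
have [d [[x0 <-] [[y0 <-] [s0 <-]]]] := ev_ex (ev_and vx (ev_and vy xyh)).
exact: valD.
Qed.

Definition completion_cst (x : K) : completion := cpi (mkcauchy (cauchy_cst v x)).

Lemma completion_cst_val (x : K) : x != 0 ->
  completion_cst x != 0 /\ completion_val_fun (completion_cst x) = v x.
Proof. by move=> x0; apply: completion_valE; exists 0. Qed.

Lemma completion_val_surj g :
  exists2 x : completion, x != 0 & completion_val_fun x = g.
Proof.
have [x x0 <-] := val_surj v g; have [? ?] := completion_cst_val x0.
by exists (completion_cst x).
Qed.

Definition completion_valuation : valuation completion G :=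
  Valuation completion_valM completion_valD completion_val_surj.

Lemma completion_cst_is_zmod_morphism : zmod_morphism completion_cst.
Proof.
move=> x y; rewrite -cpiB; apply/cpi_eq => g.
by exists 0 => d _ /=; rewrite [X in vlt _ _ X]subrr vlt0.
Qed.

Lemma completion_cst_is_monoid_morphism : monoid_morphism completion_cst.
Proof.
split=> [|x y]; rewrite -?cpi1 -?cpiM; apply/cpi_eq => g;
  by exists 0 => d _ /=; rewrite [X in vlt _ _ X]subrr vlt0.
Qed.

HB.instance Definition _ := GRing.isZmodMorphism.Build K completion
  completion_cst completion_cst_is_zmod_morphism.
HB.instance Definition _ := GRing.isMonoidMorphism.Build K completion
  completion_cst completion_cst_is_monoid_morphism.

Lemma completion_valuation_cst (x : K) :
  x != 0 -> completion_valuation (completion_cst x) = v x.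
Proof. by move=> /completion_cst_val[]. Qed.

Lemma completion_vlt (a : cauchy) g :
  eventually (fun d => vlt v g (net a d)) -> vlt completion_valuation g (cpi a).
Proof.
move=> ag; rewrite /vlt; case: eqVneq => //= a0.
have [h ah] := cauchy_val (@netP a) (elimN (cpi_eq0 a) a0).
have [_ ->] := completion_valE ah.
by have [d [[d0 <-]]] := ev_ex (ev_and ah ag); rewrite /vlt (negPf d0).
Qed.

Lemma completion_net_cvg (a : cauchy) :
  net_cvg completion_valuation (fun d => completion_cst (net a d)) (cpi a).
Proof.
move=> g; have [d0 ca] := netP a g; exists d0 => d dd.
rewrite -cpiB; apply: completion_vlt; exists d0 => e de /=.
exact: ca.
Qed.

Lemma completion_dense (x : completion) (g : G) :
  exists y : K, vlt completion_valuation g (x - completion_cst y).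
Proof.
have [d] := ev_ex (completion_net_cvg (repr x) g).
by rewrite cpi_repr vltBC => xd; exists (net (repr x) d).
Qed.

Lemma completion_complete (A : G -> completion) :
  cauchy_net completion_valuation A ->
  exists x, net_cvg completion_valuation A x.
Proof.
move=> cA; have [a Aa] := choice (fun d => completion_dense (A d) d).
have na : null_net completion_valuation (fun d => A d - completion_cst (a d)).
  by move=> g; exists g => d gd; apply: vlt_trans (Aa d).
have ca : cauchy_net v a.
  move=> g; have /(_ g)[d0 cd] := cauchyB cA (null_cauchy na).
  exists d0 => d e dd de; have := cd _ _ dd de.
  have subNK (x y : completion) : x - (x - y) = y by rewrite opprB addrC subrK.
  rewrite !subNK -completion_cst_is_zmod_morphism /vlt fmorph_eq0.
  by case: eqVneq => //= ade; rewrite [completion_val_fun _](completion_cst_val ade).2.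
exists (cpi (mkcauchy ca)) => g.
apply: ev_imp (nullD na (completion_net_cvg (mkcauchy ca)) g) => d /=.
by rewrite addrA subrK.
Qed.

End Completion.

Definition p_divisible (G : zmodType) (p : nat) : Prop :=
  forall g : G, exists h : G, g = h *+ p.

(* Surjectivity of [x |-> x ^+ p] from [R / pR] to itself, written out on
   representatives. *)
Definition frobenius_mod_surjective (R : comNzRingType) (p : nat) : Prop :=
  forall y : R, exists x z : R, y - x ^+ p = p%:R * z.

Definition DRst (K : fieldType) (G : orderedZmodType) (v : valuation K G)
    (p : nat) : Prop :=
  p_divisible G p.

Definition DRvr (K : fieldType) (G : orderedZmodType) (v : valuation K G)
    (p : nat) : Prop :=
  frobenius_mod_surjective (vring (completion_valuation v)) p.

Definition semitame (K : fieldType) (G : orderedZmodType) (v : valuation K G) :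
    Prop :=
  [pchar residue_field v] =i pred0 \/
  exists p : nat, [/\ p \in [pchar residue_field v], DRst v p & DRvr v p].

Definition artin_schreier (K : fieldType) (p : nat) (L : splittingFieldType K) :
    Prop :=
  galois 1 {:L} /\ \dim {:L} = p.

Definition isomorphic_over (K : fieldType) (L M : splittingFieldType K) : Prop :=
  exists f : {lrmorphism L -> M}, bijective f.

(* Distinct Artin-Schreier extensions are usually counted inside a fixed
   algebraic closure of [K]. Being normal, two of them coincide there if and
   only if they are isomorphic over [K]; they are counted here up to
   isomorphism over [K]. *)
Definition finitely_many_artin_schreier (K : fieldType) (p : nat) : Prop :=
  exists (n : nat) (E : 'I_n -> splittingFieldType K),
    forall L : splittingFieldType K,
      artin_schreier p L -> exists i : 'I_n, isomorphic_over L (E i).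

(* Main.v *)
Require Import Defs.
From HB Require Import structures.
From mathcomp Require Import all_boot all_order all_algebra all_field.
From mathcomp Require Import boolp.
(* The names [val1] and [valM] of the group library are to be shadowed. *)
Import Defs.

(** Write P(y) = y ^+ p - y. It is an additive map on K, and the whole proof rests
    on one consequence of the hypothesis: the image P(K) has finite index in K
    ([artin_schreier_finite_index]). Indeed, for w outside P(K) a root of
    X^p - X - w generates an Artin-Schreier extension of K, and if infinitely
    many w, pairwise incongruent modulo P(K), had to share finitely many such
    extensions E, two of them would have roots z and z' in the same E that each
    automorphism of E translates both by the same element of the prime field.
    Then z - z' is fixed by all automorphisms, hence lies in K, and
    w - w' = P(z - z') is in P(K).

    Finite index of P(K) constrains the valuation because an element of P(K) of
    negative value has the value p * v(y) for some y.

    - The value group is p-divisible ([value_group_p_divisible]). Otherwise there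
      are elements of the values g, (1 + p) g, (1 + 2 p) g, ... with g < 0 not
      divisible by p. The value of a difference of two of them is again one of
      these values, hence is not divisible by p, so no such difference is in P(K).

    - The p-th powers are dense in K ([pth_powers_dense]). Given a, among the
      elements a t^p, a (t^2)^p, a (t^3)^p, ... with v(t) very negative two are
      congruent modulo P(K), so a c^p = y^p - y with v(c) <= v(t). Dividing by c^p,
      the element a is approximated by the p-th power of y / c up to y / c^p, and
      y / c^p has a large value since v(y) is about v(c).

    By density, taking p-th roots along Cauchy nets shows that the completion is a
    perfect field ([completion_perfect]). As p = 0 there, this is the surjectivity
    of the Frobenius map on its valuation ring modulo p. *)

Set Implicit Arguments.
Unset Strict Implicit.
Unset Printing Implicit Defensive.

Import Order.TTheory GRing.Theory.
Local Open Scope ring_scope.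

(** * The Artin-Schreier map and its polynomials *)

Section ArtinSchreierMap.
Variables (R : comNzRingType) (p : nat).
Hypothesis charRp : p \in [pchar R].
Implicit Types x y : R.

Lemma pchar_exprB x y : (x - y) ^+ p = x ^+ p - y ^+ p.
Proof. by have := pFrobenius_autB_comm charRp (mulrC x y). Qed.

Lemma pchar_exprD_nat x (c : nat) : (x + c%:R) ^+ p = x ^+ p + c%:R.
Proof.
have pFM := pFrobenius_autD_comm charRp (mulrC x c%:R).
by move: pFM; rewrite pFrobenius_aut_nat.
Qed.

Definition artin_schreier_map x := x ^+ p - x.

Lemma artin_schreier_mapB x y :
  artin_schreier_map (x - y) = artin_schreier_map x - artin_schreier_map y.
Proof.
rewrite /artin_schreier_map pchar_exprB !opprB [y - x]addrC addrACA.
by rewrite [- y ^+ p + y]addrC.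
Qed.

Lemma artin_schreier_mapD_nat x (c : nat) :
  artin_schreier_map (x + c%:R) = artin_schreier_map x.
Proof. by rewrite /artin_schreier_map pchar_exprD_nat opprD addrACA subrr addr0. Qed.

End ArtinSchreierMap.

Lemma rmorph_artin_schreier_map (R S : comNzRingType) (p : nat)
    (f : {rmorphism R -> S}) (x : R) :
  f (artin_schreier_map p x) = artin_schreier_map p (f x).
Proof. by rewrite /artin_schreier_map rmorphB rmorphXn. Qed.

Section ArtinSchreierPolynomial.
Variables (F : fieldType) (p : nat).
Hypothesis charFp : p \in [pchar F].
Implicit Types z w : F.

Definition artin_schreier_poly w : {poly F} := 'X^p - 'X - w%:P.

Definition artin_schreier_roots z : seq F :=
  [seq z + c%:R | c <- iota 0 p].

Let p_gt1 : (1 < p)%N. Proof. exact/prime_gt1/(pcharf_prime charFp). Qed.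

Lemma artin_schreier_polyE w :
  artin_schreier_poly w = 'X^p + - ('X + w%:P).
Proof. by rewrite opprD addrA. Qed.

Lemma size_artin_schreier_poly w : size (artin_schreier_poly w) = p.+1.
Proof.
by rewrite artin_schreier_polyE size_polyDl size_polyXn// size_polyN size_XaddC.
Qed.

Lemma artin_schreier_poly_monic w : artin_schreier_poly w \is monic.
Proof.
rewrite artin_schreier_polyE monicE lead_coefDl ?lead_coefXn//.
by rewrite size_polyN size_XaddC size_polyXn.
Qed.

Lemma root_artin_schreier_poly w z :
  root (artin_schreier_poly w) z = (artin_schreier_map p z == w).
Proof. by rewrite rootE !hornerE subr_eq0. Qed.

Lemma artin_schreier_roots_uniq z : uniq (artin_schreier_roots z).
Proof.
rewrite map_inj_in_uniq ?iota_uniq// => c d.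
rewrite !mem_iota !add0n/= => cp dp /addrI.
wlog cd : c d cp dp / (c <= d)%N => [IH|].
  by have [/IH|/ltnW/IH IH' /esym/IH'] := leqP c d; [exact | move->].
move/esym/eqP; rewrite -subr_eq0 -natrB// -(dvdn_pcharf charFp) => pd.
apply/anti_leq; rewrite cd -subn_eq0/=.
apply: contraTT pd; rewrite -lt0n => /gtnNdvd->//.
by rewrite (leq_ltn_trans (leq_subr _ _)).
Qed.

(** Since P is additive and kills the prime field, one root gives them all. *)
Lemma artin_schreier_poly_prod w z : artin_schreier_map p z = w ->
  artin_schreier_poly w = \prod_(x <- artin_schreier_roots z) ('X - x%:P).
Proof.
move=> zw; have /monicP lc := artin_schreier_poly_monic w.
rewrite {1}(@all_roots_prod_XsubC _ (artin_schreier_poly w)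
  (artin_schreier_roots z)) ?lc ?scale1r//.
- by rewrite size_artin_schreier_poly size_map size_iota.
- apply/allP => x /mapP[c _ ->].
  by rewrite root_artin_schreier_poly artin_schreier_mapD_nat// zw.
- by rewrite uniq_rootsE artin_schreier_roots_uniq.
Qed.

Lemma artin_schreier_map_fiber z z' :
    artin_schreier_map p z' = artin_schreier_map p z ->
  exists2 c, (c < p)%N & z' = z + c%:R.
Proof.
move=> /eqP; rewrite -root_artin_schreier_poly (artin_schreier_poly_prod erefl).
by rewrite root_prod_XsubC => /mapP[c]; rewrite mem_iota => cp ->; exists c.
Qed.

End ArtinSchreierPolynomial.

(** * Artin-Schreier extensions *)

Lemma irreducible_factor (F : fieldType) (q : {poly F}) : (1 < size q)%N ->
  exists2 r, irreducible_poly r & r %| q.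
Proof.
elim: {q}(size q) {-2}q (leqnn (size q)) => [q q0|n IHn q qn q1].
  by rewrite ltnNge (leq_trans q0).
have [irr|/existsNP[r]] := pselect
  (forall r : {poly F}, size r != 1%N -> r %| q -> r %= q).
  by exists q.
case: (eqVneq (size r) 1%N) => [_ []//|r1] /not_implyP[_] /not_implyP[rq /negP nrq].
have q0 : q != 0 by rewrite -size_poly_eq0 -lt0n ltnW.
have r0 : r != 0 by apply: contraNneq q0 => r0; move: rq; rewrite r0 dvd0p.
have [s irr_s sr] : exists2 s, irreducible_poly s & s %| r.
  apply: IHn.
    by rewrite -ltnS (leq_trans _ qn)// ltn_neqAle dvdp_leq// andbT dvdp_size_eqp.
  by rewrite ltn_neqAle eq_sym r1 lt0n size_poly_eq0.
by exists s => //; apply: dvdp_trans rq.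
Qed.

(** Finiteness of the index of P(K) in the additive group of K, in the form in
    which it is used: no infinite sequence is pairwise incongruent modulo P(K). *)
Definition artin_schreier_image_finite_index (K : fieldType) (p : nat) : Prop :=
  forall u : nat -> K,
    exists i j y, i <> j /\ u i - u j = artin_schreier_map p y.

Section ArtinSchreierExtension.
Variables (K : fieldType) (p : nat).
Hypothesis charKp : p \in [pchar K].

Lemma artin_schreier_poly_over (L : fieldExtType K) (w : K) :
  artin_schreier_poly p (w%:A : L) \is a polyOver 1%VS.
Proof. by rewrite !rpredB ?rpredX ?polyOverX ?polyOverC ?rpredZ ?rpred1. Qed.

(** The minimal polynomial of z over K is the product of the X - (z + c) for c in
    a set s of residues modulo p, and its subleading coefficient is - n z plus an
    element of the prime field, where n is the number of elements of s. If
    0 < n < p then n is invertible in K, so z itself lies in K, against the choice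
    of w. *)
Lemma artin_schreier_degree (L : fieldExtType K) (z : L) (w : K) :
  artin_schreier_map p z = w%:A -> (forall y, artin_schreier_map p y <> w) ->
  adjoin_degree 1%VS z = p.
Proof.
move=> zw Nw.
have charLp : p \in [pchar L] by rewrite pchar_lalg.
have := @minPoly_dvdp _ _ 1%AS z _ (artin_schreier_poly_over L w).
rewrite root_artin_schreier_poly zw eqxx => /(_ isT).
move=> mw; move: (mw).
rewrite (artin_schreier_poly_prod charLp zw) => /dvdp_prod_XsubC[m].
rewrite -map_mask; set s := mask m _.
rewrite eqp_monic ?monic_minPoly ?monic_prod_XsubC//.
move=> /eqP mE; have := size_minPoly 1%AS z.
rewrite mE size_prod_XsubC size_map => -[sz].
have s_gt0 : (0 < size s)%N by rewrite sz.
have /polyOverP/(_ (size s).-1) := minPolyOver 1%VS z.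
have := dvdp_leq (monic_neq0 (artin_schreier_poly_monic charLp _)) mw.
rewrite size_artin_schreier_poly// size_minPoly -sz ltnS leq_eqVlt.
move=> /predU1P[//|sp]; rewrite mE -[in X in X -> _](size_map (fun c => z + c%:R) s).
rewrite coefPn_prod_XsubC ?size_map -?lt0n// big_map big_split/=.
rewrite big_const_seq count_predT iter_addr_0.
have s0 : (size s)%:R != 0 :> K by rewrite -(dvdn_pcharf charKp) gtnNdvd.
rewrite rpredN rpredDr; last by apply: rpred_sum => i _; apply: rpredMn; apply: rpred1.
move=> zs; have /vlineP[k zk] : z \in 1%VS.
  rewrite (_ : z = (size s)%:R^-1 *: (z *+ size s)) ?rpredZ//.
  by rewrite -scaler_nat scalerA mulVf// scale1r.
case: (Nw k); apply: (fmorph_inj (in_alg L)).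
by rewrite rmorph_artin_schreier_map /= -zk.
Qed.

Lemma artin_schreier_splitting (L : fieldExtType K) (z : L) (w : K) :
    artin_schreier_map p z = w%:A -> <<1; z>>%VS = fullv ->
  splittingFieldFor 1 (artin_schreier_poly p (w%:A : L)) fullv.
Proof.
move=> zw genz; have charLp : p \in [pchar L] by rewrite pchar_lalg.
exists (artin_schreier_roots p z).
  by rewrite (artin_schreier_poly_prod charLp zw) eqpxx.
apply/eqP; rewrite eqEsubv subvf -genz; apply/FadjoinP; split.
  exact: subv_adjoin_seq.
apply: seqv_sub_adjoin; apply/mapP; exists 0%N; last by rewrite addr0.
by rewrite mem_iota/= prime_gt0// (pcharf_prime charKp).
Qed.

(** The root is adjoined through an irreducible factor of X^p - X - w, which
    [artin_schreier_degree] shows afterwards to be of degree p. *)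
Lemma artin_schreier_extension (w : K) :
    (forall y, artin_schreier_map p y <> w) ->
  exists L : splittingFieldType K, artin_schreier p L /\
    exists z : L, artin_schreier_map p z = w%:A.
Proof.
move=> Nw.
have [|q irr_q qw] := @irreducible_factor _ (artin_schreier_poly p w).
  by rewrite size_artin_schreier_poly// ltnS prime_gt0// (pcharf_prime charKp).
have [L _ [z qz genz]] := irredp_FAdjoin irr_q.
have charLp : p \in [pchar L] by rewrite pchar_lalg.
have zw : artin_schreier_map p z = w%:A.
  apply/eqP; rewrite -root_artin_schreier_poly.
  have : map_poly (in_alg L) q %| map_poly (in_alg L) (artin_schreier_poly p w).
    by rewrite dvdp_map.
  rewrite /artin_schreier_poly !rmorphB/= map_polyXn map_polyX map_polyC/=.
  by move=> /root_dvdp; apply.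
have splits := artin_schreier_splitting zw genz.
have axL : SplittingField.axiom L.
  by exists (artin_schreier_poly p (w%:A : L)) => //; apply: artin_schreier_poly_over.
pose LM := FieldExt_isSplittingField.Build K L axL.
pose M : splittingFieldType K := HB.pack L LM.
exists M; split; last by exists z.
split.
  apply/splitting_galoisField; exists (artin_schreier_poly p (w%:A : L)); split.
  - exact: artin_schreier_poly_over.
  - rewrite (artin_schreier_poly_prod charLp zw) separable_prod_XsubC.
    exact: artin_schreier_roots_uniq.
  - exact: splits.
have := dim_Fadjoin 1%AS z.
by rewrite (artin_schreier_degree zw Nw) genz dimv1 muln1.
Qed.

(** For w outside P(K), z + 1 is a conjugate of z over K by
    [artin_schreier_degree], hence the image of z under an automorphism of the
    normal extension E. *)
Lemma artin_schreier_fixed (E : splittingFieldType K) (z : E) (w : K) :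
    artin_schreier_map p z = w%:A ->
    (forall s : gal_of {:E}, s \in 'Gal({:E} / 1%AS)%g -> s z = z) ->
  exists y, artin_schreier_map p y = w.
Proof.
move=> zw fixz; apply: contrapT => /forallNP Nw.
have charEp : p \in [pchar E] by rewrite pchar_lalg.
have degz := artin_schreier_degree zw Nw.
have mE : minPoly 1%VS z = artin_schreier_poly p (w%:A : E).
  apply/eqP; rewrite -eqp_monic ?monic_minPoly ?artin_schreier_poly_monic//.
  rewrite -dvdp_size_eqp ?size_minPoly ?degz ?size_artin_schreier_poly//.
  rewrite (@minPoly_dvdp _ _ 1%AS) ?artin_schreier_poly_over//.
  by rewrite root_artin_schreier_poly zw.
have [||s sG] := @normalField_root_minPoly _ _ 1%AS {:E}%AS z (z + 1%:R)
  (sub1v _) (normalFieldf _).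
- exact: memvf.
- by rewrite mE root_artin_schreier_poly artin_schreier_mapD_nat// zw.
rewrite fixz// => /eqP; rewrite -subr_eq0 opprD addrA subrr sub0r oppr_eq0.
by rewrite oner_eq0.
Qed.

Lemma artin_schreier_gal (E : splittingFieldType K) (z : E) (w : K) (s : gal_of {:E}) :
  artin_schreier_map p z = w%:A -> exists c : 'I_p, s z = z + (c : nat)%:R.
Proof.
move=> zw; have charEp : p \in [pchar E] by rewrite pchar_lalg.
have [|c cp ->] := @artin_schreier_map_fiber E p charEp z (s z); last first.
  by exists (Ordinal cp).
by rewrite -(rmorph_artin_schreier_map p s) zw; apply: rmorph_alg.
Qed.

(** Each w_i is coloured by an extension E k that contains a root z of
    X^p - X - w_i, together with the map that sends an automorphism s of E k to the
    residue s z - z modulo p. There are finitely many colours, and two elements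
    of the same colour are congruent modulo P(K) by [artin_schreier_fixed]. *)
Theorem artin_schreier_finite_index :
  finitely_many_artin_schreier K p -> artin_schreier_image_finite_index K p.
Proof.
move=> [n [E EP]] u; apply: contrapT => Nu.
have inj_u i j y : u i - u j = artin_schreier_map p y -> i = j.
  by move=> uij; apply: contrapT => ij; apply: Nu; exists i, j, y.
(* Differences with u 0, so that no w i is in P(K). *)
pose w i := u i.+1 - u 0%N.
pose T := {k : 'I_n & {ffun gal_of {:E k} -> 'I_p}}.
have colour i : exists t : T, exists2 z : E (tag t), artin_schreier_map p z = (w i)%:A &
    forall s : gal_of {:E (tag t)}, s z = z + (tagged t s : nat)%:R.
  have [|L [asL [z zw]]] := @artin_schreier_extension (w i).
    by move=> y /esym/inj_u.
  have [k [f _]] := EP L asL.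
  have fzw : artin_schreier_map p (f z) = (w i)%:A.
    by rewrite -rmorph_artin_schreier_map zw; apply: rmorph_alg.
  have [c cP] := choice (fun s : gal_of {:E k} => artin_schreier_gal s fzw).
  exists (Tagged (fun k => {ffun gal_of {:E k} -> 'I_p}) [ffun s => c s]).
  by exists (f z) => //= s; rewrite ffunE cP.
have [t tP] := choice colour.
have /injectivePn[i [j ij tij]] : ~~ injectiveb (fun i : 'I_(#|{: T}|.+1) => t i).
  by apply/injectiveP => /leq_card; rewrite card_ord ltnn.
have [zi ziw si] := tP i; have := tP j; rewrite -tij => -[zj zjw sj].
have charEp : p \in [pchar (E (tag (t i)))] by rewrite pchar_lalg.
have [| |y yw] := @artin_schreier_fixed _ (zi - zj) (w i - w j).
- by rewrite artin_schreier_mapB// ziw zjw -scalerBl.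
- by move=> s _; rewrite rmorphB/= si sj opprD addrACA subrr addr0.
move: yw; rewrite /w opprB addrA subrK => /esym/inj_u[] ij'.
by move/eqP: ij; apply; apply: val_inj.
Qed.

End ArtinSchreierExtension.

(** * Multiples in an ordered group *)

Section OrderedMultiples.
Variable G : orderedZmodType.
Implicit Types x y : G.

Lemma oz_leMn n x y : x <= y -> x *+ n <= y *+ n.
Proof.
by move=> xy; elim: n => [|n IH]; rewrite ?mulr0n// !mulrS oz_leDD.
Qed.

Lemma oz_ltMn n x y : x < y -> x *+ n.+1 < y *+ n.+1.
Proof. by move=> xy; rewrite !mulrS oz_lt_leD ?oz_leMn ?ltW. Qed.

Lemma oz_lt_pMn x m n : 0 < x -> (m < n)%N -> x *+ m < x *+ n.
Proof.
move=> x0 mn; rewrite -(subnKC (ltnW mn)) mulrnDr -{1}[x *+ m]addr0 oz_ltD2l.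
rewrite -subn_gt0 in mn; case: (n - m)%N mn => // k _.
by rewrite -(mul0rn _ k.+1) oz_ltMn.
Qed.

Lemma oz_ltN x y : (- x < - y) = (y < x).
Proof. by rewrite -(oz_ltD2l x (- x)) subrr -(oz_ltD2r y 0) add0r subrK. Qed.

Lemma oz_leN x y : (- x <= - y) = (y <= x).
Proof. by rewrite !leNgt oz_ltN. Qed.

Lemma oz_le_pMn x n : 0 <= x -> (0 < n)%N -> x <= x *+ n.
Proof.
by case: n => // n x0 _; rewrite mulrS -{1}[x]addr0 oz_leD2l -(mul0rn _ n) oz_leMn.
Qed.

End OrderedMultiples.

(** * Consequences of the finite index for the valuation *)

Section Valuations.
Variables (K : fieldType) (G : orderedZmodType) (v : valuation K G).
Implicit Types x y : K.

Lemma valX x n : x != 0 -> v (x ^+ n) = v x *+ n.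
Proof.
move=> x0; elim: n => [|n IH]; first by rewrite expr0 val1.
by rewrite exprS mulrS valM ?expf_neq0// IH.
Qed.

Lemma vleX g x n : (0 < n)%N -> vle v (g *+ n) (x ^+ n) = vle v g x.
Proof.
case: n => // n _; rewrite /vle expf_eq0/=; case: eqVneq => //= x0.
rewrite valX//; case: (leP g (v x)) => gx; first by rewrite oz_leMn.
by apply/negbTE; rewrite -ltNge oz_ltMn.
Qed.

Lemma vltX g x n : (0 < n)%N -> vlt v (g *+ n) (x ^+ n) = vlt v g x.
Proof.
case: n => // n _; rewrite /vlt expf_eq0/=; case: eqVneq => //= x0.
rewrite valX//; case: (ltP g (v x)) => gx; first by rewrite oz_ltMn.
by apply/negbTE; rewrite -leNgt oz_leMn.
Qed.

Lemma val_sub_lt x y : x != 0 -> y != 0 -> v x < v y -> x - y != 0 /\ v (x - y) = v x.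
Proof. by move=> x0 y0 xy; apply: val_close => //; rewrite vltN /vlt xy orbT. Qed.

Lemma val_artin_schreier_map p y : (1 < p)%N -> ~~ vle v 0 y ->
  v (artin_schreier_map p y) = v y *+ p.
Proof.
move=> p1; rewrite /vle negb_or -ltNge => /andP[y0 vy].
rewrite /artin_schreier_map -valX//; apply: (val_sub_lt _ _ _).2; rewrite ?expf_neq0//.
rewrite valX// -oz_ltN -mulNrn -{1}[- v y]mulr1n; apply: oz_lt_pMn => //.
by rewrite -oz_ltN opprK oppr0.
Qed.

Lemma vle_artin_schreier_map p y : vle v 0 y -> vle v 0 (artin_schreier_map p y).
Proof.
move=> Oy; apply: vleD; last by rewrite vleN.
case: p => [|p]; first by rewrite expr0 /vle val1 lexx orbT.
by rewrite -(mul0rn _ p.+1) vleX.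
Qed.

Lemma nontrivial_unbounded (g : G) : nontrivial_valuation v ->
  exists t, [/\ t != 0, v t < 0 & g < - v t].
Proof.
move=> [x x0 vx].
have [h h0] : exists h : G, 0 < h.
  have [vxn|vxp|/eqP] := ltgtP (v x) 0; last by rewrite (negPf vx).
    by exists (- v x); rewrite -oz_ltN opprK oppr0.
  by exists (v x).
have [t t0 vt] := val_surj v (- (Order.max g 0 + h)).
exists t; split; rewrite // vt ?opprK.
  rewrite -oz_ltN opprK oppr0 (lt_le_trans h0)// -[X in X <= _]add0r oz_leD2r.
  by rewrite le_max lexx orbT.
by rewrite -[X in X < _]addr0 oz_le_ltD// le_max lexx.
Qed.

(** An element y outside the valuation ring has v (P y) = p * v y, and P maps the
    valuation ring to itself. So the negative, not p-divisible values v (x k - x l)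
    are not taken on P(K). *)
Lemma value_group_p_divisible p : (1 < p)%N ->
  artin_schreier_image_finite_index K p -> p_divisible G p.
Proof.
move=> p1 fin g; apply: contrapT => /forallNP ndiv.
have p0 : (0 < p)%N := ltnW p1.
wlog g0 : g ndiv / g < 0 => [IH|].
  have [g0|g0|g0] := ltgtP g 0; first exact: IH ndiv g0.
    apply: (IH (- g)) => [h gh|]; last by rewrite -oz_ltN opprK oppr0.
    by apply: (ndiv (- h)); rewrite mulNrn -gh opprK.
  by apply: (ndiv 0); rewrite mul0rn.
pose e i := g *+ (i * p).+1.
have /choice[x xP] i : exists x, x != 0 /\ v x = e i.
  by have [x] := val_surj v (e i); exists x.
have [i [j [y [ij]]]] := fin x.
have e_lt k l : (k < l)%N -> e l < e k.
  move=> kl; rewrite -oz_ltN -!mulNrn oz_lt_pMn//; last by rewrite ltnS ltn_pmul2r.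
  by rewrite -oz_ltN opprK oppr0.
have vxy k l z : k <> l -> x k - x l = artin_schreier_map p z ->
    exists m, v (artin_schreier_map p z) = e m /\ artin_schreier_map p z != 0.
  have [[xk0 vk] [xl0 vl]] := (xP k, xP l).
  move=> /eqP; rewrite neq_ltn => /orP[] kl <-.
    exists l; rewrite -opprB valN oppr_eq0 -vl.
    by have [] : _ := val_sub_lt xl0 xk0 _; rewrite ?vk ?vl ?e_lt.
  exists k; rewrite -vk.
  by have [] : _ := val_sub_lt xk0 xl0 _; rewrite ?vk ?vl ?e_lt.
move=> /(vxy _ _ _ ij)[m [vm m0]].
have [/(vle_artin_schreier_map p)|Oy] := boolP (vle v 0 y).
  rewrite /vle (negPf m0) vm/= leNgt -(mul0rn _ (m * p).+1).
  by rewrite oz_ltMn.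
move: vm; rewrite val_artin_schreier_map// /e mulrSr mulrnA => /eqP.
rewrite addrC -subr_eq => /eqP E; apply: (ndiv (v y - g *+ m)).
by rewrite mulrnBl.
Qed.

(** From a c^p = y^p - y, the error a - (y / c)^p is - y / c^p. If y is integral its
    value is at least - p v(c). Otherwise p v(y) = v(a) + p v(c), so that p times
    the value of the error is v(a) - p (p - 1) v(c). *)
Lemma pth_powers_dense p : p \in [pchar K] -> nontrivial_valuation v ->
    artin_schreier_image_finite_index K p ->
  forall (a : K) (g : G), exists b, vlt v g (a - b ^+ p).
Proof.
move=> charKp ntv fin a g; have p1 := prime_gt1 (pcharf_prime charKp).
have p0 := ltnW p1.
have [->|a0] := eqVneq a 0; first by exists 0; rewrite expr0n gtn_eqF// subrr vlt0.
(* For the c found below and m = - v c >= - v t, the two cases of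
   the estimate need g < p m and p g < v a + p (p - 1) m; as p > 1 these follow
   from g < m and p g < v a + m. *)
have [t [t0 vt0 vt]] := nontrivial_unbounded (Order.max g (g *+ p - v a)) ntv.
move: vt; rewrite gt_max => /andP[gt gat].
have [i [j [y [ij]]]] := fin (fun i => a * (t ^+ i.+1) ^+ p).
have [c c0 [vc ->]] : exists2 c, c != 0 & v c <= v t /\
    a * (t ^+ i.+1) ^+ p - a * (t ^+ j.+1) ^+ p = a * c ^+ p.
  have vtX k l : (k < l)%N -> v (t ^+ l.+1) < v (t ^+ k.+1).
    move=> kl; rewrite !valX// -oz_ltN -!mulNrn oz_lt_pMn//.
    by rewrite -oz_ltN opprK oppr0.
  have vtle k : v (t ^+ k.+1) <= v t.
    by rewrite valX// -oz_leN -mulNrn oz_le_pMn// -oz_leN opprK oppr0 ltW.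
  have tX k := expf_neq0 k.+1 t0.
  exists (t ^+ i.+1 - t ^+ j.+1); last first.
  - split; last by rewrite pchar_exprB// mulrBr.
    move/eqP: ij; rewrite neq_ltn => /orP[] ij.
      by rewrite -opprB valN (val_sub_lt _ _ (vtX _ _ ij)).2// vtle.
    by rewrite (val_sub_lt _ _ (vtX _ _ ij)).2// vtle.
  - move/eqP: ij; rewrite neq_ltn => /orP[] ij.
      by rewrite -opprB oppr_eq0 (val_sub_lt _ _ (vtX _ _ ij)).1.
    by rewrite (val_sub_lt _ _ (vtX _ _ ij)).1.
move=> acy; exists (y / c); rewrite exprMn exprVn.
have cp0 := expf_neq0 p c0.
rewrite (_ : a = artin_schreier_map p y / c ^+ p); last by rewrite -acy mulfK.
rewrite -mulrBl /artin_schreier_map addrAC subrr add0r mulNr vltN.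
have [Oy|Oy] := boolP (vle v 0 y).
  rewrite -[g]add0r vltM// /vlt invr_eq0 (negPf cp0) valV// valX//=.
  rewrite (lt_le_trans gt)// -mulNrn (le_trans _ (oz_le_pMn _ p0)) ?oz_leN//.
  by rewrite -oz_leN opprK oppr0 (le_trans vc)// ltW.
have vy := val_artin_schreier_map p1 Oy; move: Oy; rewrite /vle negb_or => /andP[y0 _].
rewrite -(vltX _ _ p0) /vlt expf_eq0 p0/= mulf_eq0 (negPf y0) invr_eq0 (negPf cp0)/=.
rewrite valX ?mulf_neq0 ?invr_eq0// valM ?invr_eq0// mulrnDl -vy -acy valM//.
rewrite valV// valX//.
rewrite -(subrK (v a) (g *+ p)) addrC -addrA oz_ltD2l (lt_le_trans gat)//.
have vc0 : 0 <= - v c by rewrite -oz_leN opprK oppr0 (le_trans vc)// ltW.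
rewrite (_ : _ + _ = - v c *+ (p * p - p)); last first.
  by rewrite mulrnBr ?leq_pmulr// mulrnA !mulNrn opprK addrC.
rewrite (le_trans (_ : _ <= - v c)) ?oz_leN// oz_le_pMn//.
by rewrite subn_gt0 ltn_Pmull.
Qed.

End Valuations.

(** * The completion and the residue field *)

Section Completion.
Variables (K : fieldType) (G : orderedZmodType) (v : valuation K G) (p : nat).
Hypothesis charKp : p \in [pchar K].

Lemma netX (a : cauchy v) n d : net (a ^+ n) d = net a d ^+ n.
Proof. by elim: n => [//|n IH]; rewrite !exprS -IH. Qed.

Lemma cpiX (a : cauchy v) n : cpi (a ^+ n) = cpi a ^+ n.
Proof. by elim: n => [|n IH]; rewrite ?expr0 ?cpi1// !exprS cpiM IH. Qed.

(** If b d is a p-th root of the d-th term of a Cauchy net up to an error of value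
    larger than d, then b is again Cauchy, because v ((x - y)^p) = p v (x - y) and
    (x - y)^p = x^p - y^p. *)
Lemma completion_perfect :
  (forall (a : K) (g : G), exists b, vlt v g (a - b ^+ p)) ->
  forall a : completion v, exists b, b ^+ p = a.
Proof.
move=> dense a; have p0 := prime_gt0 (pcharf_prime charKp).
have [b ab] := choice (fun d => dense (net (repr a) d) d).
have cb : cauchy_net v b.
  move=> g; have [d0 ca] := netP (repr a) (g *+ p).
  exists (Order.max d0 (g *+ p)) => d e; rewrite !ge_max => /andP[d0d gd] /andP[d0e ge].
  rewrite -(vltX _ _ _ p0) pchar_exprB//.
  rewrite (_ : _ - _ = (net (repr a) d - net (repr a) e)
    - ((net (repr a) d - b d ^+ p) - (net (repr a) e - b e ^+ p))).
    apply: vltB; first exact: ca.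
    by apply: vltB; apply: vlt_trans (ab _).
  by rewrite [in RHS]opprB [in RHS]addrA subrKA [in RHS]opprB [in RHS]addrC subrKA.
exists (cpi (mkcauchy cb)); rewrite -cpiX -[RHS]cpi_repr; apply/cpi_eq => g.
by exists g => d gd; rewrite netX vltBC; apply: vlt_trans (ab d).
Qed.

(** A p-th root of an integral element is integral. *)
Lemma completion_DRvr : (forall a : completion v, exists b, b ^+ p = a) -> DRvr v p.
Proof.
move=> perf y; have [b by_] := perf (vring_val y).
have Ob : b \in vring_pred (completion_valuation v).
  rewrite /in_mem/= /vring_pred.
  rewrite -(vleX _ _ _ (prime_gt0 (pcharf_prime charKp))) by_ mul0rn.
  exact: vring_valP.
exists (VRing Ob), 0; rewrite mulr0; apply/eqP; rewrite subr_eq0; apply/eqP.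
by apply: val_inj; rewrite rmorphXn.
Qed.

Lemma residue_pchar : p \in [pchar residue_field v].
Proof.
rewrite inE (pcharf_prime charKp)/=.
have p0 : (p%:R : vring v) = 0.
  by apply: val_inj; rewrite rmorph_nat rmorph0 (pcharf0 charKp).
by rewrite -(rmorph_nat (\pi_(residue_field v))%qT) p0 rmorph0.
Qed.

End Completion.

Theorem theorem1p1 (K : fieldType) (G : orderedZmodType) (v : valuation K G)
    (p : nat) (charKp : p \in [pchar K]) (v_nontrivial : nontrivial_valuation v)
    (finitely_many_AS : finitely_many_artin_schreier K p) :
  semitame v.
Proof.
have fin := artin_schreier_finite_index charKp finitely_many_AS.
right; exists p; split.
- exact: residue_pchar.
- exact: value_group_p_divisible (prime_gt1 (pcharf_prime charKp)) fin.
- by apply/completion_DRvr/completion_perfect/pth_powers_dense.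
Qed.
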